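(* Let $f(a,\alpha)$ be a symmetric function on $\widetilde{\mathbb C}^{n|n}$. Then: 1) there exists a unique function $g(x_1,\dots,x_n,\xi_1,\dots,\xi_n)$ defined on the open subsupermanifold $\check{\mathbb C}^{n|n}\subset\mathbb C^{n|n}$ such that $g(t_1,\dots,t_n,\tau_1,\dots,\tau_n)=f$; 2) if $f$ is a polynomial function, then so is $g$, and if $f$ is a rational function, then so is $g$.
   Context: $\mathbb C^{n|n}$ is the complex superspace with even coordinates $a_1,\dots,a_n$ and odd coordinates $\alpha_1,\dots,\alpha_n$; functions on an open subsuperdomain are expressions $\sum_{I}\alpha^{I}f_I(a)$ with $f_I$ holomorphic on the underlying open subset of $\mathbb C^n$, the $\alpha_i$ being anticommuting. Such a function is polynomial (rational) if all $f_I$ are polynomial (rational). $\widetilde{\mathbb C}^{n|n}$ is the open subsuperdomain whose underlying set $\widetilde{\mathbb C}^n$ consists of $n$-tuples of pairwise distinct complex numbers. The group $S_n$ acts on $\widetilde{\mathbb C}^{n|n}$ by simultaneously permuting the indices of the $a_i$ and of the $\alpha_i$; a function is called symmetric if it is $S_n$-invariant. Put $$t_k=\sum_i a_i^k,\qquad \tau_k=\sum_i\alpha_i a_i^{k-1}.$$ $\check{\mathbb C}^{n|n}$ is the image of $\widetilde{\mathbb C}^{n|n}$ in $\mathbb C^{n|n}$ under the map with components $(t_1,\dots,t_n,\tau_1,\dots,\tau_n)$, i.e. the open subsuperdomain of $\mathbb C^{n|n}$ (even coordinates $x_i$, odd coordinates $\xi_i$) whose underlying set is the image of $\widetilde{\mathbb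 C}^n$ under $(t_1,\dots,t_n)$. *)

(* Defs.v *)
From HB Require Import structures.
From mathcomp Require Import all_boot all_order all_algebra all_fingroup.

Set Implicit Arguments.
Unset Strict Implicit.
Unset Printing Implicit Defensive.

Import Order.TTheory GRing.Theory Num.Theory.
Local Open Scope ring_scope.

(* The Grassmann algebra over K on odd generators alpha_0, ..., alpha_(n-1):   *)
(* g stands for \sum_I g I *: alpha^I, where alpha^I is the product of the     *)
(* alpha_i, i in I, taken in increasing order of the indices.                  *)
Definition grassmann (K : comNzRingType) (n : nat) := {ffun {set 'I_n} -> K}.

Section Grassmann.
Variables (K : comNzRingType) (n : nat).
Implicit Types (I J L : {set 'I_n}) (c : K).

HB.instance Definition _ := GRing.Zmodule.on (grassmann K n).

Implicit Types f g h : grassmann K n.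

(* alpha^I * alpha^J = (-1) ^+ inversions I J *: alpha^(I :|: J) for disjoint  *)
(* I and J; the product is 0 when I and J meet.                                *)
Definition inversions I J : nat := \sum_(i in I) \sum_(j in J) (j < i)%N.

Definition grassmann_one : grassmann K n := [ffun I => (I == set0)%:R].

Definition grassmann_mul f g : grassmann K n :=
  [ffun L : {set 'I_n} => \sum_(I : {set 'I_n} | I \subset L)
               (-1) ^+ inversions I (L :\: I) * (f I * g (L :\: I))].

Definition grassmann_scale c f : grassmann K n := [ffun I => c * f I].

Fact inversions0s J : inversions set0 J = 0%N.
Proof. by rewrite /inversions big_set0. Qed.

Fact inversionss0 I : inversions I set0 = 0%N.
Proof. by rewrite /inversions big1 // => i _; rewrite big_set0. Qed.

Fact inversionsUl I J L : [disjoint I & J] ->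
  inversions (I :|: J) L = (inversions I L + inversions J L)%N.
Proof. by move=> dIJ; rewrite /inversions -bigU //=; apply: eq_bigl => i; rewrite !inE. Qed.

Fact inversionsUr I J L : [disjoint J & L] ->
  inversions I (J :|: L) = (inversions I J + inversions I L)%N.
Proof.
move=> dJL; rewrite /inversions -big_split /=; apply: eq_bigr => i _.
by rewrite -bigU //=; apply: eq_bigl => j; rewrite !inE.
Qed.

Fact grassmann_mulA : associative grassmann_mul.
Proof.
move=> f g h; apply/ffunP=> L; rewrite !ffunE.
transitivity (\sum_(I : {set 'I_n} | I \subset L) \sum_(J : {set 'I_n} | J \subset L :\: I)
   (-1) ^+ (inversions I (L :\: I) + inversions J (L :\: I :\: J))
     * (f I * g J * h (L :\: I :\: J))).
  apply: eq_bigr => I _; rewrite ffunE !mulr_sumr; apply: eq_bigr => J _.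
  by rewrite exprD -!mulrA; congr (_ * _); rewrite !mulrA [f I * _]mulrC.
transitivity (\sum_(M : {set 'I_n} | M \subset L)
  \sum_(I : {set 'I_n} | I \subset M)
   (-1) ^+ (inversions M (L :\: M) + inversions I (M :\: I))
     * (f I * g (M :\: I) * h (L :\: M))); last first.
  apply: eq_bigr => M _; rewrite ffunE mulr_suml mulr_sumr.
  by apply: eq_bigr => I _; rewrite exprD -!mulrA.
rewrite [RHS](exchange_big_dep (fun I : {set 'I_n} => I \subset L)) /=; last first.
  by move=> M I sML sIM; apply: subset_trans sML.
apply: eq_bigr => I sIL.
rewrite [RHS](reindex_onto (fun J : {set 'I_n} => I :|: J)
  (fun M : {set 'I_n} => M :\: I)) /=; last first.
  by move=> M /andP[_ sIM]; rewrite setDE setUIr setUCr setIT; apply/setUidPr.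
apply: eq_big => J.
  rewrite subUset sIL subsetUl andbT /= subsetD.
  by rewrite setDUl setDv set0U (sameP setDidPl eqP).
rewrite subsetD => /andP[sJL dJI].
have dIJ : [disjoint I & J] by rewrite disjoint_sym.
have -> : (I :|: J) :\: I = J.
  by rewrite setDUl setDv set0U; apply/setDidPl.
have -> : L :\: I :\: J = L :\: (I :|: J) by rewrite setDDl.
congr (_ ^+ _ * _).
have -> : L :\: I = J :|: (L :\: (I :|: J)).
  apply/setP=> x; rewrite !inE; case xI: (x \in I) => /=.
    by rewrite (disjointFr dIJ xI).
  by case xJ: (x \in J) => //=; apply: (subsetP sJL).
rewrite inversionsUr ?inversionsUl //; last first.
  by rewrite disjoints_subset; apply/subsetP=> x xJ; rewrite !inE xJ orbT.
by rewrite -addnA addnC.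
Qed.

Fact grassmann_mul1 : left_id grassmann_one grassmann_mul.
Proof.
move=> f; apply/ffunP=> L; rewrite ffunE (bigD1 set0) ?sub0set //= big1.
  by rewrite ffunE eqxx inversions0s setD0 !mul1r addr0.
by move=> I /andP[_ /negPf nI0]; rewrite ffunE nI0 mul0r mulr0.
Qed.

Fact grassmann_mulr1 : right_id grassmann_one grassmann_mul.
Proof.
move=> f; apply/ffunP=> L; rewrite ffunE (bigD1 L) //= big1.
  by rewrite ffunE setDv eqxx inversionss0 mul1r mulr1 addr0.
move=> I /andP[sIL nIL]; rewrite ffunE setD_eq0.
suff /negPf-> : ~~ (L \subset I) by rewrite !mulr0.
by apply: contra nIL => sLI; rewrite eqEsubset sIL.
Qed.

Fact grassmann_mulDl : left_distributive grassmann_mul +%R.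
Proof.
move=> f g h; apply/ffunP=> L; rewrite !ffunE -big_split /=.
by apply: eq_bigr => I _; rewrite ffunE mulrDl mulrDr.
Qed.

Fact grassmann_mulDr : right_distributive grassmann_mul +%R.
Proof.
move=> f g h; apply/ffunP=> L; rewrite !ffunE -big_split /=.
by apply: eq_bigr => I _; rewrite ffunE !mulrDr.
Qed.

Fact grassmann_one_neq0 : grassmann_one != 0.
Proof.
by apply/eqP => /ffunP/(_ set0); rewrite !ffunE eqxx => /eqP; rewrite oner_eq0.
Qed.

HB.instance Definition _ := GRing.Zmodule_isNzRing.Build (grassmann K n)
  grassmann_mulA grassmann_mul1 grassmann_mulr1
  grassmann_mulDl grassmann_mulDr grassmann_one_neq0.

Fact grassmann_scaleA c c' f :
  grassmann_scale c (grassmann_scale c' f) = grassmann_scale (c * c') f.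
Proof. by apply/ffunP=> I; rewrite !ffunE mulrA. Qed.

Fact grassmann_scale1 : left_id 1 grassmann_scale.
Proof. by move=> f; apply/ffunP=> I; rewrite ffunE mul1r. Qed.

Fact grassmann_scaleDr : right_distributive grassmann_scale +%R.
Proof. by move=> c f g; apply/ffunP=> I; rewrite !ffunE mulrDr. Qed.

Fact grassmann_scaleDl f :
  {morph grassmann_scale^~ f : c c' / c + c' >-> c + c'}.
Proof. by move=> c c'; apply/ffunP=> I; rewrite !ffunE mulrDl. Qed.

HB.instance Definition _ := GRing.Zmodule_isLmodule.Build K (grassmann K n)
  grassmann_scaleA grassmann_scale1 grassmann_scaleDr grassmann_scaleDl.

Definition odd_coord (i : 'I_n) : grassmann K n := [ffun I => (I == [set i])%:R].

End Grassmann.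

From mathcomp Require Import all_classical topology normedtype derive.
(* the notations of mpoly clash with those of mathcomp-analysis *)
From mathcomp Require Import -(notations) mpoly.
Import numFieldNormedType.Exports.

Section Superfunctions.
Variables (C : numFieldType) (n : nat).

(* Only C := complex R with R a realType is of interest.                        *)

(* A function \sum_I alpha^I f_I(a) on a superdomain of C^{n|n} is the map     *)
(* a |-> (f_I(a))_I. Only its values on the underlying open set are relevant:  *)
(* two such maps are the same function on the superdomain with underlying set  *)
(* U when they agree on U.                                                     *)
Definition superfun := 'rV[C]_n -> grassmann C n.

(* [differentiable] is differentiability over C, so on an open U this says     *)
(* that every coefficient f_I is holomorphic.                                  *)
Definition superfun_on (U : set 'rV[C]_n) (f : superfun) : Prop :=
  forall (I : {set 'I_n}) (a : 'rV[C]_n),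
    U a -> differentiable (fun x : 'rV[C]_n => f x I : C) a.

(* The value at the even arguments x and odd arguments xi of                   *)
(* f = \sum_I xi^I f_I(x).                                                     *)
Definition supereval (f : superfun) (x : 'rV[C]_n)
    (xi : 'I_n -> grassmann C n) : grassmann C n :=
  \sum_(I : {set 'I_n}) f x I *: \prod_(i <- enum I) xi i.

Definition polynomial_superfun (U : set 'rV[C]_n) (f : superfun) : Prop :=
  forall I : {set 'I_n}, exists p : mpoly n C,
    forall x, U x -> f x I = meval (x ord0) p.

Definition rational_superfun (U : set 'rV[C]_n) (f : superfun) : Prop :=
  forall I : {set 'I_n}, exists p q : mpoly n C, q != 0 /\
    forall x, U x -> meval (x ord0) q != 0 ->
      f x I = meval (x ord0) p / meval (x ord0) q.

(* the underlying set of \widetilde{C}^{n|n} *)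
Definition distinct_points : set 'rV[C]_n :=
  [set a | injective (fun i : 'I_n => a ord0 i)]%classic.

Definition symmetric_superfun (f : superfun) : Prop :=
  forall (s : 'S_n) (a : 'rV[C]_n), distinct_points a ->
    supereval f (col_perm s a) (fun i => odd_coord C (s i)) = f a.

(* With indices starting at 0, the k-th entries of [even_t] and [odd_tau] are  *)
(* t_(k+1) and tau_(k+1).                                                      *)
Definition even_t (a : 'rV[C]_n) : 'rV[C]_n :=
  \row_(k < n) \sum_(i < n) a ord0 i ^+ k.+1.

Definition odd_tau (a : 'rV[C]_n) (k : 'I_n) : grassmann C n :=
  \sum_(i < n) a ord0 i ^+ k *: odd_coord C i.

(* the underlying set of \check{C}^{n|n} *)
Definition power_sum_points : set 'rV[C]_n :=
  (even_t @` distinct_points)%classic.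

End Superfunctions.

Arguments distinct_points C n : clear implicits.
Arguments power_sum_points C n : clear implicits.

(* Main.v *)
From HB Require Import structures.
Require Import Defs.
From mathcomp Require Import all_boot all_order all_algebra all_fingroup.

(* Write V(a) for the Vandermonde matrix (a_i^k). Since tau = V(a) alpha and V(a) is
   invertible at distinct points, f(a, alpha) has a unique expansion
   \sum_I G_I(a) tau^I; this gives uniqueness, and G_I is S_n-invariant because f is.
   The fibres of t = (t_1, ..., t_n) are S_n-orbits by Newton's identities, so that
   G_I = g_I \o t for a unique g_I on the image of t.

   Multiplying f by the product of the tau_k, k \notin I, and taking the top
   coefficient isolates det V(a) * G_I(a), up to a sign, as a polynomial combination
   of the coefficients of f. Hence G_I is holomorphic. Moreover, if f is polynomial then
   det V * G_I is an antisymmetric polynomial, i.e. a combination of alternants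
   det (a_j^(m_i)); reducing 'X^m modulo \prod_j ('X - a_j) factors each alternant as
   det V(a) times a polynomial in t(a), so g_I is polynomial. If f is rational, this
   applies to D^2 f, where D is the product of all permutations of all denominators.

   Finally, t has local sections that are differentiable at a given point: the roots
   of the polynomial determined by x = t(a) depend differentiably on x as long as they
   are simple. So g_I is holomorphic. *)

Set Implicit Arguments.
Unset Strict Implicit.
Unset Printing Implicit Defensive.

Import Order.TTheory GRing.Theory Num.Theory.
Local Open Scope ring_scope.

(** * Linear substitutions in the Grassmann algebra *)

Section GrassmannAlgebra.
Variables (K : comNzRingType) (n : nat).
Implicit Types (I J L : {set 'I_n}) (f g h : grassmann K n) (i j k : 'I_n).

Lemma grassmann_mulE f g L : (f * g) L =
  \sum_(I : {set 'I_n} | I \subset L)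
     (-1) ^+ inversions I (L :\: I) * (f I * g (L :\: I)).
Proof. by rewrite [f * g]/(grassmann_mul f g) ffunE. Qed.

Lemma grassmann0E L : (0 : grassmann K n) L = 0.
Proof. by rewrite ffunE. Qed.

Lemma grassmannDE f g L : (f + g) L = f L + g L.
Proof. by rewrite ffunE. Qed.

Lemma grassmannZE (c : K) f L : (c *: f) L = c * f L.
Proof. by rewrite [c *: f]/(grassmann_scale c f) ffunE. Qed.

Lemma grassmann_sumE (T : Type) (r : seq T) (P : pred T) (F : T -> grassmann K n) L :
  (\sum_(i <- r | P i) F i) L = \sum_(i <- r | P i) F i L.
Proof.
elim/big_rec2: _ => [|i y1 y2 _ <-]; first by rewrite grassmann0E.
by rewrite grassmannDE.
Qed.

Fact grassmann_scaleAl (c : K) f g : c *: (f * g) = (c *: f) * g.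
Proof.
apply/ffunP=> L; rewrite grassmannZE !grassmann_mulE mulr_sumr.
by apply: eq_bigr => I _; rewrite grassmannZE mulrCA !mulrA.
Qed.

Fact grassmann_scaleAr (c : K) f g : c *: (f * g) = f * (c *: g).
Proof.
apply/ffunP=> L; rewrite grassmannZE !grassmann_mulE mulr_sumr.
by apply: eq_bigr => I _; rewrite grassmannZE mulrCA [f I * (c * _)]mulrCA.
Qed.

HB.instance Definition _ :=
  GRing.Lmodule_isLalgebra.Build K (grassmann K n) grassmann_scaleAl.
HB.instance Definition _ :=
  GRing.Lalgebra_isAlgebra.Build K (grassmann K n) grassmann_scaleAr.

Definition grassmann_basis I : grassmann K n := [ffun J => (J == I)%:R].

Lemma grassmann_basisE I J : grassmann_basis I J = (J == I)%:R.
Proof. by rewrite ffunE. Qed.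

Lemma odd_coordE i : odd_coord K i = grassmann_basis [set i].
Proof. by []. Qed.

Lemma grassmann_expand f : f = \sum_I f I *: grassmann_basis I.
Proof.
apply/ffunP=> J; rewrite grassmann_sumE (bigD1 J) //= big1 ?addr0.
  by rewrite grassmannZE grassmann_basisE eqxx mulr1.
by move=> I nIJ; rewrite grassmannZE grassmann_basisE eq_sym (negPf nIJ) mulr0.
Qed.

Lemma grassmann_basisM I J : grassmann_basis I * grassmann_basis J =
  if [disjoint I & J] then (-1) ^+ inversions I J *: grassmann_basis (I :|: J)
  else 0.
Proof.
apply/ffunP=> L; rewrite grassmann_mulE.
(* Only the summand indexed by [I] itself can be nonzero. *)
transitivity (if (I \subset L) && (L :\: I == J)
              then (-1) ^+ inversions I J : K else 0).
  case: (boolP (I \subset L)) => [sIL|nIL] /=.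
    rewrite (bigD1 I) //= big1 ?addr0.
      rewrite !grassmann_basisE eqxx mul1r.
      by case: eqP => [->|]; rewrite ?mulr1 ?mulr0.
    move=> I' /andP[_ /negPf nI'].
    by rewrite grassmann_basisE nI' mul0r mulr0.
  rewrite big1 // => I' sI'L; rewrite grassmann_basisE.
  by case: eqP => [eqI|]; [rewrite -eqI sI'L in nIL | rewrite mul0r mulr0].
have -> : (I \subset L) && (L :\: I == J) =
          [disjoint I & J] && (L == I :|: J).
  apply/andP/andP => [[sIL /eqP<-]|[dIJ /eqP->]].
    rewrite disjoint_sym disjoints_subset.
    have -> : I :|: L :\: I = L.
      by rewrite setDE setUIr setUCr setIT; apply/setUidPr.
    by split=> //; apply/subsetP=> x; rewrite !inE => /andP[].
  rewrite subsetUl setDUl setDv set0U; split=> //.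
  by apply/eqP/setDidPl; rewrite disjoint_sym.
case: [disjoint I & J] => /=; last by rewrite grassmann0E.
rewrite grassmannZE grassmann_basisE.
by case: ifP => _; rewrite ?mulr1 ?mulr0.
Qed.

(** * Anticommuting families and their monomials *)

Lemma inversions11 i j : inversions [set i] [set j] = (j < i)%N :> nat.
Proof. by rewrite /inversions !big_set1. Qed.

(** Vanishing squares are a separate clause: in [K], 2 may be a zero divisor, so they do not follow
    from the first one. *)
Definition anticommuting (xi : 'I_n -> grassmann K n) :=
  (forall i j, xi i * xi j = - (xi j * xi i)) /\ (forall i, xi i * xi i = 0).

Lemma anticommuting_odd_coord : anticommuting (@odd_coord K n).
Proof.
split=> [i j|i]; rewrite !odd_coordE !grassmann_basisM !disjoints1 !inE.
  rewrite eq_sym; case: eqVneq => [_|nij]; first by rewrite oppr0.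
  rewrite !inversions11 setUC -scaleNr; congr (_ *: _).
  have : val i != val j by rewrite (inj_eq val_inj) eq_sym.
  by case: ltngtP => //=; rewrite ?expr0 ?expr1 ?opprK.
by rewrite eqxx.
Qed.

(** The odd half of [supereval]: the value of f at x and [xi] is [odd_subst xi (f x)]. *)
Definition odd_subst (xi : 'I_n -> grassmann K n) h : grassmann K n :=
  \sum_(I : {set 'I_n}) h I *: \prod_(i <- enum I) xi i.

Lemma enum_ord_cat i : exists r1 r2 : seq 'I_n,
  [/\ index_enum 'I_n = r1 ++ i :: r2, all (fun k => k < i)%N r1
    & all (fun k => i < k)%N r2].
Proof.
have : pairwise (relpre val ltn) (enum 'I_n).
  rewrite -sorted_pairwise; last by move=> x y z; apply: ltn_trans.
  by rewrite -sorted_map val_enum_ord iota_ltn_sorted.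
have -> : enum 'I_n = index_enum 'I_n by rewrite enumT /index_enum unlock.
have : i \in index_enum 'I_n by rewrite mem_index_enum.
case/splitPr => r1 r2; rewrite pairwise_cat /= => /and3P[].
rewrite allrel_consr => /andP[r1i _] _ /andP[ir2 _].
by exists r1, r2; split.
Qed.

Lemma big_enum_ord (A : Type) (op : A -> A -> A) (x : A) (I : {set 'I_n})
    (F : 'I_n -> A) :
  \big[op/x]_(k <- enum I) F k = \big[op/x]_(k in I) F k.
Proof. by rewrite -[RHS]big_filter deprecated_filter_index_enum. Qed.

(** The least element of [I] splits off from a monomial without a sign, which drives the inductions
    on [#|I|]. *)
Lemma set_min I : I != set0 -> exists2 i, i \in I & inversions [set i] (I :\ i) = 0%N.
Proof.
case/set0Pn => i0 i0I.
case: (arg_minnP (fun k : 'I_n => val k) i0I) => i iI mini; exists i => //.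
rewrite /inversions big_set1 big1 // => k; rewrite !inE => /andP[_ /mini].
by rewrite ltnNge => ->.
Qed.

Section Anticommuting.
Variable xi : 'I_n -> grassmann K n.
Hypothesis xiP : anticommuting xi.
Local Notation X I := (\prod_(k <- enum I) xi k).

Lemma anticommuting_prod (r : seq 'I_n) (P : pred 'I_n) i :
  xi i * (\prod_(k <- r | P k) xi k)
  = (-1) ^+ count P r *: ((\prod_(k <- r | P k) xi k) * xi i).
Proof.
elim: r => [|k r IHr]; first by rewrite !big_nil expr0 scale1r mulr1 mul1r.
rewrite !big_cons /=; case: (P k); rewrite ?add0n //=.
rewrite mulrA xiP.1 mulNr -!mulrA IHr -scalerAr addnC addn1 exprS mulN1r scaleNr.
by [].
Qed.

(** Moving [xi i] to its sorted place passes exactly the factors of smaller index, whose number is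
    [inversions [set i] J]. If [i] is in [J], it meets itself and the square vanishes. *)
Lemma mul_odd_prod i J : xi i * X J =
  if i \in J then 0 else (-1) ^+ inversions [set i] J *: X (i |: J).
Proof.
have [r1 [r2 [er r1i r2i]]] := enum_ord_cat i.
have ni1 : i \notin r1 by apply/negP=> /(allP r1i); rewrite ltnn.
have ni2 : i \notin r2 by apply/negP=> /(allP r2i); rewrite ltnn.
rewrite !big_enum_ord /= er !big_cat !big_cons /= !inE eqxx /=.
case: ifP => iJ.
  rewrite mulrA anticommuting_prod -scalerAl -!mulrA (mulrA (xi i) (xi i)).
  by rewrite xiP.2 mul0r mulr0 scaler0.
rewrite mulrA anticommuting_prod -scalerAl -mulrA.
have cong r : i \notin r -> \prod_(k <- r | k \in i |: J) xi k = \prod_(k <- r | k \in J) xi k.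
  move=> nir; rewrite big_seq_cond [RHS]big_seq_cond; apply: eq_bigl => k.
  case: (boolP (k \in r)) => //= kr; rewrite !inE.
  by case: eqP => // ek; rewrite ek (negPf nir) in kr.
congr (_ ^+ _ *: _); last by rewrite !cong.
rewrite /inversions big_set1 er big_cat big_cons /= iJ.
rewrite [Z in (_ + Z)%N]big1_seq ?addn0; last first.
  by move=> k /andP[_ /(allP r2i)]; case: ltngtP.
rewrite -sum1_count -[in RHS]big_mkcondr /= big_seq_cond [RHS]big_seq_cond.
by apply: eq_bigl => k; case: (boolP (k \in r1)) => //= /(allP r1i) ->; rewrite andbT.
Qed.

Lemma prod_odd_set0 : X set0 = 1.
Proof. by rewrite big_enum_ord big_set0. Qed.

(** Any anticommuting family obeys the multiplication rule of the basis monomials; this is what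
    makes [odd_subst] multiplicative. *)
Lemma mul_prod_odd I J : X I * X J =
  if [disjoint I & J] then (-1) ^+ inversions I J *: X (I :|: J) else 0.
Proof.
have [m] := ubnP #|I|; elim: m => // m IHm in I *; rewrite ltnS => leIm.
have [->|nI0] := eqVneq I set0.
  by rewrite prod_odd_set0 mul1r inversions0s set0U disjoints_subset sub0set scale1r.
have [i iI inv0] := set_min nI0.
have dI : [disjoint [set i] & I :\ i] by rewrite disjoints1 !inE eqxx.
have XI : X I = xi i * X (I :\ i).
  by rewrite mul_odd_prod !inE eqxx inv0 scale1r setD1K.
rewrite XI -mulrA IHm; last by move: leIm; rewrite (cardsD1 i) iI.
have -> : [disjoint I & J] = (i \notin J) && [disjoint I :\ i & J].
  by rewrite -{1}(setD1K iI) !disjoints_subset subUset sub1set inE.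
case: ifP => [dIJ|]; last by rewrite andbF mulr0.
rewrite -scalerAr mul_odd_prod !inE eqxx /= andbT.
case: ifP => _ /=; first by rewrite scaler0.
rewrite inversionsUr // inv0 add0n scalerA -exprD setUA setD1K //.
congr (_ ^+ _ *: _); rewrite addnC -inversionsUl ?setD1K //.
Qed.

End Anticommuting.

(** * Odd substitution as an algebra morphism *)

Fact odd_subst_is_linear xi : linear (odd_subst xi).
Proof.
move=> c f g; rewrite /odd_subst scaler_sumr -big_split /=.
by apply: eq_bigr => I _; rewrite grassmannDE grassmannZE scalerDl scalerA.
Qed.

HB.instance Definition _ xi :=
  GRing.isLinear.Build K (grassmann K n) (grassmann K n) _ (odd_subst xi)
    (odd_subst_is_linear xi).

Lemma odd_subst_basis xi I :
  odd_subst xi (grassmann_basis I) = \prod_(i <- enum I) xi i.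
Proof.
rewrite /odd_subst (bigD1 I) //= [X in _ + X]big1 ?addr0.
  by rewrite grassmann_basisE eqxx scale1r.
by move=> J /negPf nJI; rewrite grassmann_basisE nJI scale0r.
Qed.

Lemma odd_subst_coord xi i : odd_subst xi (odd_coord K i) = xi i.
Proof. by rewrite odd_coordE odd_subst_basis enum_set1 big_seq1. Qed.

Lemma odd_substM xi f g : anticommuting xi ->
  odd_subst xi (f * g) = odd_subst xi f * odd_subst xi g.
Proof.
move=> xiP; rewrite {1}(grassmann_expand f) {1}(grassmann_expand g).
rewrite {2 3}/odd_subst mulr_suml [in RHS]mulr_suml linear_sum.
apply: eq_bigr => I _ /=; rewrite !mulr_sumr linear_sum; apply: eq_bigr => J _ /=.
rewrite -!scalerAr -!scalerAl !linearZ /= !scalerA.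
congr (_ *: _); first by rewrite mulrC.
rewrite grassmann_basisM mul_prod_odd //; case: ifP => _; last by rewrite linear0.
by rewrite linearZ /= odd_subst_basis.
Qed.

Lemma odd_subst1 xi : odd_subst xi 1 = 1.
Proof.
have -> : 1 = grassmann_basis set0 by [].
by rewrite odd_subst_basis big_enum_ord big_set0.
Qed.

Lemma odd_subst_prod xi (r : seq 'I_n) (F : 'I_n -> grassmann K n) :
  anticommuting xi ->
  odd_subst xi (\prod_(i <- r) F i) = \prod_(i <- r) odd_subst xi (F i).
Proof.
move=> xiP; elim: r => [|i r IHr]; first by rewrite !big_nil odd_subst1.
by rewrite !big_cons odd_substM // IHr.
Qed.

Lemma prod_odd_coord I : \prod_(i <- enum I) odd_coord K i = grassmann_basis I.
Proof.
have [m] := ubnP #|I|; elim: m => // m IHm in I *; rewrite ltnS => leIm.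
have [->|nI0] := eqVneq I set0.
  by rewrite big_enum_ord big_set0.
have [i iI inv0] := set_min nI0.
have := mul_odd_prod anticommuting_odd_coord i (I :\ i).
rewrite !inE eqxx /= inv0 scale1r setD1K // => <-.
rewrite IHm; last by move: leIm; rewrite (cardsD1 i) iI.
by rewrite grassmann_basisM disjoints1 !inE eqxx inv0 scale1r setD1K.
Qed.

Lemma odd_subst_id f : odd_subst (@odd_coord K n) f = f.
Proof.
rewrite {2}(grassmann_expand f); apply: eq_bigr => I _.
by rewrite prod_odd_coord.
Qed.

(** * Substitution of linear forms *)

Definition linear_forms (M : 'M[K]_n) i : grassmann K n :=
  \sum_k M i k *: odd_coord K k.

Lemma anticommuting_linear_forms M : anticommuting (linear_forms M).
Proof.
have anti (c d : 'I_n -> K) r s :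
    (\sum_(k <- r) c k *: odd_coord K k) * (\sum_(k <- s) d k *: odd_coord K k)
    = - ((\sum_(k <- s) d k *: odd_coord K k) * (\sum_(k <- r) c k *: odd_coord K k)).
  rewrite !mulr_suml -sumrN; under eq_bigr => k _ do rewrite mulr_sumr.
  under [RHS]eq_bigr => k _ do rewrite mulr_sumr -sumrN.
  rewrite exchange_big /=; apply: eq_bigr => k _; apply: eq_bigr => l _.
  rewrite -!scalerAl -!scalerAr !scalerA anticommuting_odd_coord.1.
  by rewrite scalerN mulrC.
split=> [i j|i]; first exact: anti.
(* Anticommutation only gives that twice the square is 0; so the square is expanded term by term,
   the cross terms cancelling by [anti]. *)
rewrite /linear_forms; elim: (index_enum _) => [|k r IHr].
  by rewrite big_nil mul0r.
rewrite big_cons mulrDl !mulrDr IHr addr0 -!scalerAl -scalerAr.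
rewrite anticommuting_odd_coord.2 !scaler0 add0r.
have := anti (fun j => M i j) (fun j => M i j) [:: k] r.
by rewrite big_seq1 -scalerAl => ->; rewrite addNr.
Qed.

Lemma odd_subst_linear_forms N M i :
  odd_subst (linear_forms N) (linear_forms M i) = linear_forms (M *m N) i.
Proof.
rewrite linear_sum /=; under eq_bigr => k _ do rewrite linearZ /= odd_subst_coord scaler_sumr.
rewrite exchange_big /=; apply: eq_bigr => l _.
by rewrite mxE scaler_suml; apply: eq_bigr => k _; rewrite scalerA.
Qed.

Lemma odd_subst_comp N M f :
  odd_subst (linear_forms N) (odd_subst (linear_forms M) f)
  = odd_subst (linear_forms (M *m N)) f.
Proof.
rewrite [odd_subst (linear_forms M) f]/odd_subst linear_sum.
apply: eq_bigr => I _; rewrite linearZ /=.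
rewrite odd_subst_prod; last exact: anticommuting_linear_forms.
by congr (_ *: _); apply: eq_bigr => i _; exact: odd_subst_linear_forms.
Qed.

Lemma linear_forms_perm (s : 'S_n) i : linear_forms (perm_mx s) i = odd_coord K (s i).
Proof.
rewrite /linear_forms (bigD1 (s i)) //= big1 ?addr0 => [|k /negPf nk].
  by rewrite !mxE eqxx scale1r.
by rewrite !mxE eq_sym nk scale0r.
Qed.

Lemma linear_forms1 i : linear_forms 1%:M i = odd_coord K i.
Proof. by rewrite -perm_mx1 linear_forms_perm perm1. Qed.

Lemma eq_odd_subst xi eta : xi =1 eta -> odd_subst xi =1 odd_subst eta.
Proof.
by move=> e f; apply: eq_bigr => I _; congr (_ *: _); apply: eq_bigr => i _.
Qed.

Lemma odd_subst_linear_forms1 f : odd_subst (linear_forms 1%:M) f = f.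
Proof. by rewrite (eq_odd_subst linear_forms1) odd_subst_id. Qed.
 

(** * Top-degree products and determinants *)

Lemma anticommuting_comp xi (F : 'I_n -> 'I_n) :
  anticommuting xi -> anticommuting (xi \o F).
Proof. by move=> [xiN xi0]; split=> [i j|i] /=; [exact: xiN | exact: xi0]. Qed.

(** The sign is chosen before [xi], so that it is the same for two families that are to be
    compared. *)
Lemma prod_oddT2 i j : i != j -> exists s : bool, forall xi, anticommuting xi ->
  \prod_(k <- enum [set: 'I_n]) xi k =
  (-1) ^+ s *: (xi i * xi j * \prod_(k <- enum (~: [set i; j])) xi k).
Proof.
move=> nij; pose D := ~: [set i; j].
exists (odd (inversions [set i] (j |: D) + inversions [set j] D)) => xi xiP.
rewrite -mulrA mul_odd_prod //; rewrite !inE eqxx orbT /=.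
rewrite -scalerAr mul_odd_prod // !inE eqxx (negPf nij) /=.
rewrite !scalerA signr_odd exprD -!mulrA signrMK -expr2 sqrr_sign scale1r.
by rewrite setUA setUCr.
Qed.

Lemma prod_odd_tperm xi i j : anticommuting xi -> i != j ->
  \prod_(k <- enum [set: 'I_n]) xi (tperm i j k)
  = - \prod_(k <- enum [set: 'I_n]) xi k.
Proof.
move=> xiP nij; have [s sP] := prod_oddT2 nij.
rewrite (sP _ xiP); have /= -> := sP _ (anticommuting_comp (tperm i j) xiP).
rewrite tpermL tpermR xiP.1 mulNr scalerN; congr (- (_ *: (_ * _))).
rewrite !big_enum_ord; apply: eq_bigr => k; rewrite !inE negb_or => /andP[nki nkj].
by rewrite tpermD // eq_sym.
Qed.

Lemma prod_odd_perm xi (s : 'S_n) : anticommuting xi ->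
  \prod_(k <- enum [set: 'I_n]) xi (s k)
  = (-1) ^+ s *: \prod_(k <- enum [set: 'I_n]) xi k.
Proof.
move=> xiP; have [ts -> {s}] := prod_tpermP s.
elim: ts xi xiP => [|[i j] ts IHts] xi xiP /=.
  by rewrite big_nil odd_perm1 scale1r; under eq_bigr do rewrite perm1.
case/andP=> nij tsP; rewrite big_cons; set s := (\prod_(t <- ts) _)%g.
under eq_bigr do rewrite permM /=.
rewrite (prod_odd_tperm (anticommuting_comp s xiP) nij) /= IHts // -scaleNr.
by rewrite odd_permM odd_tperm nij signr_addb expr1 mulN1r.
Qed.

Lemma prod_odd_eq0 xi (F : 'I_n -> 'I_n) i j : anticommuting xi -> i != j ->
  F i = F j -> \prod_(k <- enum [set: 'I_n]) xi (F k) = 0.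
Proof.
move=> xiP nij eF; have [s sP] := prod_oddT2 nij.
have /= -> := sP _ (anticommuting_comp F xiP).
by rewrite eF xiP.2 mul0r scaler0.
Qed.

Lemma linear_forms_eq0 M i L : #|L| != 1%N -> linear_forms M i L = 0.
Proof.
move=> nL1; rewrite grassmann_sumE big1 // => k _.
rewrite grassmannZE odd_coordE grassmann_basisE.
by case: eqP => [eL|]; [rewrite eL cards1 in nL1 | rewrite mulr0].
Qed.

Lemma prod_linear_forms_eq0 M (r : seq 'I_n) L : #|L| != size r ->
  (\prod_(i <- r) linear_forms M i) L = 0.
Proof.
elim: r L => [|i r IHr] L /= nL.
  rewrite big_nil; have -> : 1 = grassmann_basis set0 by [].
  by rewrite grassmann_basisE; move: nL; rewrite cards_eq0 => /negPf->.
rewrite big_cons grassmann_mulE big1 // => I sIL.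
have [I1|nI1] := eqVneq #|I| 1%N; last by rewrite linear_forms_eq0 // mul0r mulr0.
rewrite IHr ?mulr0 //; rewrite cardsD (setIidPr sIL) I1.
by apply: contra nL => /eqP<-; rewrite subn1 prednK // -I1 subset_leq_card.
Qed.

(** Expanding gives a sum over all maps F of the index set to itself. Maps with a repeated value
    contribute 0, and the permutations give the Leibniz formula. *)
Lemma prod_linear_formsT M :
  \prod_(i <- enum [set: 'I_n]) linear_forms M i = \det M *: grassmann_basis setT.
Proof.
have enumT_big (F : 'I_n -> grassmann K n) :
  \prod_(i <- enum [set: 'I_n]) F i = \prod_i F i.
  by rewrite big_enum_ord; apply: eq_bigl => i; rewrite inE.
rewrite enumT_big /linear_forms bigA_distr_bigA /=.
under eq_bigr => F _ do rewrite scaler_prod.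
rewrite (bigID (fun F : {ffun 'I_n -> 'I_n} => injectiveb F)) /= addrC.
rewrite [X in X + _]big1 ?add0r => [|F /injectivePn[i [j nij eF]]]; last first.
  by rewrite -enumT_big (prod_odd_eq0 anticommuting_odd_coord nij eF) scaler0.
rewrite (reindex (@pval _)) /=; last first.
  pose in_Sn := insubd (1%g : 'S_n).
  by exists in_Sn => /= f Uf; first apply: val_inj; apply: insubdK.
rewrite scaler_suml; apply: eq_big => [s|s _]; first exact: (valP s).
under eq_bigr do rewrite pvalE.
rewrite -enumT_big; under [X in _ *: X]eq_bigr do rewrite pvalE.
rewrite (prod_odd_perm s anticommuting_odd_coord) prod_odd_coord scalerA.
by rewrite mulrC.
Qed.

(** By degree, only the top monomial of [h] reaches the top coefficient. *)
Lemma odd_subst_top M h :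
  odd_subst (linear_forms M) h setT = \det M * h setT.
Proof.
rewrite grassmann_sumE (bigD1 setT) //= [X in _ + X]big1 ?addr0.
  by rewrite grassmannZE prod_linear_formsT grassmannZE grassmann_basisE eqxx mulr1 mulrC.
move=> I nIT; rewrite grassmannZE prod_linear_forms_eq0 ?mulr0 //.
rewrite -cardE; apply: contra nIT => /eqP eI.
by rewrite eqEcard subsetT eI leqnn.
Qed.

Lemma grassmann_mul_basisC_top h I :
  (h * grassmann_basis (~: I)) setT = (-1) ^+ inversions I (~: I) * h I.
Proof.
rewrite grassmann_mulE (bigD1 I) ?subsetT //= big1 ?addr0.
  by rewrite setTD grassmann_basisE eqxx mulr1.
move=> J /andP[_ nJI]; rewrite setTD grassmann_basisE.
by rewrite (inj_eq (@setC_inj _)) (negPf nJI) !mulr0.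
Qed.

(* Cramer's rule for the substitution alpha |-> M alpha. *)
Lemma det_mul_coef M h I : \det M * h I = (-1) ^+ inversions I (~: I) *
  (odd_subst (linear_forms M) h * \prod_(i <- enum (~: I)) linear_forms M i) setT.
Proof.
rewrite -odd_subst_basis -odd_substM; last exact: anticommuting_linear_forms.
rewrite odd_subst_top grassmann_mul_basisC_top mulrCA.
by rewrite signrMK.
Qed.

End GrassmannAlgebra.

From mathcomp Require Import zify ring.
From mathcomp Require Import all_classical all_reals topology normedtype landau derive.
From mathcomp Require Import complex.
From mathcomp Require Import -(notations) mpoly.
Import numFieldNormedType.Exports.

(** * Power sums and symmetric polynomials *)

Lemma deriv_prod (K : comNzRingType) (I : eqType) (r : seq I) (F : I -> {poly K}) :
  uniq r -> (\prod_(i <- r) F i)^`()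
    = \sum_(j <- r) (F j)^`() * \prod_(i <- r | i != j) F i.
Proof.
elim: r => [|x r IHr] /=; first by rewrite !big_nil -polyC1 derivC.
case/andP=> xr ur; rewrite !big_cons derivM eqxx /= IHr //; congr (_ * _ + _).
  rewrite big_seq [RHS]big_seq_cond; apply: eq_bigl => i.
  by case: (boolP (i \in r)) => //= ir; case: eqP => // ei; rewrite -ei ir in xr.
rewrite big_distrr /= big_seq [RHS]big_seq; apply: eq_bigr => j jr.
rewrite big_cons; case: eqP => [ei|_]; first by rewrite ei jr in xr.
by rewrite mulrCA.
Qed.

(** * Newton's identities and the fibres of the power sum map *)

Section PowerSums.
Variables (C : numFieldType) (n : nat).
Implicit Types (a b x : 'rV[C]_n).

Definition root_poly a : {poly C} := \prod_j ('X - (a ord0 j)%:P).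

Lemma size_root_poly a : size (root_poly a) = n.+1.
Proof. by rewrite /root_poly size_prod_XsubC /index_enum unlock -enumT size_enum_ord. Qed.

Lemma root_poly_monic a : root_poly a \is monic.
Proof. exact: monic_prod_XsubC. Qed.

Lemma coef_root_poly_lead a : (root_poly a)`_n = 1.
Proof. by have /monicP := root_poly_monic a; rewrite lead_coefE size_root_poly. Qed.

(** With P = [root_poly a] and [Pj j] = P / (X - a_j), the derivative of P is the sum of the [Pj j].
    The identity compares coefficients, those of [Pj j] being obtained from P by synthetic
    division. *)
Lemma newton_identity a k : (k <= n)%N ->
  k%:R * (root_poly a)`_(n - k)
  = - \sum_(i < n | (i < k)%N) even_t a ord0 i * (root_poly a)`_(n - k + i.+1).
Proof.
move=> le_kn; set P := root_poly a; set m := (n - k)%N.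
pose Pj j := \prod_(i | i != j) ('X - (a ord0 i)%:P).
have PE j : P = 'X * Pj j - (a ord0 j)%:P * Pj j.
  by rewrite -mulrBl /P /root_poly (bigD1 j).
have szPj j : (size (Pj j) <= n)%N.
  have := size_root_poly a; rewrite -/P (PE j) -mulrBl size_Mmonic; last 2 first.
  - by rewrite monic_neq0 // monicXsubC.
  - exact: monic_prod_XsubC.
  by rewrite size_XsubC add2n => -[->].
(* Synthetic division: P = (X - a_j) Pj gives (Pj)_l = P_(l+1) + a_j (Pj)_(l+1), here iterated [N]
   times. *)
have Pj_coef j l N : (Pj j)`_l =
    \sum_(i < N) a ord0 j ^+ i * P`_(l + i.+1) + a ord0 j ^+ N * (Pj j)`_(l + N).
  elim: N => [|N IHN]; first by rewrite big_ord0 add0r mul1r addn0.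
  rewrite big_ord_recr /= IHN -addrA; congr (_ + _).
  rewrite [in P`__](PE j) coefB coefXM coefCM addnS /=.
  by rewrite exprSr -mulrA -mulrDr subrK.
have dP : P^`() = \sum_j Pj j.
  rewrite /P /root_poly deriv_prod ?index_enum_uniq //.
  by apply: eq_bigr => j _; rewrite derivXsubC mul1r.
have nP : n%:R * P`_m = m%:R * P`_m - \sum_j a ord0 j * (Pj j)`_m.
  have -> : m%:R * P`_m = ('X * P^`())`_m.
    by rewrite coefXM coef_deriv; case: (m) => [|m'] /=; rewrite ?mul0r // mulr_natl.
  rewrite dP mulr_sumr coef_sum -sumrB.
  transitivity (\sum_(j < n) P`_m); first by rewrite sumr_const card_ord mulr_natl.
  by apply: eq_bigr => j _; rewrite {1}(PE j) coefB coefCM.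
have -> : k%:R * P`_m = n%:R * P`_m - m%:R * P`_m.
  by rewrite -mulrBl -natrB ?leq_subr // /m subKn.
rewrite nP addrAC subrr sub0r; congr (- _).
have Pjm j : a ord0 j * (Pj j)`_m =
    \sum_(i < n | (i < k)%N) a ord0 j ^+ i.+1 * P`_(m + i.+1).
  (* The iteration ends at index m + k = n, which exceeds the degree of [Pj j]. *)
  rewrite (Pj_coef j m k) [(Pj j)`_(m + k)]nth_default ?mulr0 ?addr0; last first.
    by rewrite /m subnK.
  rewrite (big_ord_widen n (fun i => a ord0 j ^+ i * P`_(m + i.+1)) le_kn).
  by rewrite mulr_sumr; apply: eq_bigr => i _; rewrite exprS mulrA.
under eq_bigr => j _ do rewrite Pjm.
rewrite exchange_big /=; apply: eq_bigr => i _.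
by rewrite mxE mulr_suml.
Qed.

(** The recursion uses all earlier values, so the whole list is carried along, latest value
    first. *)
Fixpoint newton_coefs k : seq (mpoly n C) :=
  if k is k'.+1 then
    (- (k%:R^-1) *: \sum_(i < n | (i <= k')%N)
       mpolyX C (mnm1 i) * nth 0 (newton_coefs k') i) :: newton_coefs k'
  else [:: 1].

(* By Newton's identities, the coefficient of degree n - k of a monic polynomial
   of degree n as a polynomial in the power sums of its roots. *)
Definition newton_coef k : mpoly n C := head 0 (newton_coefs k).

Lemma nth_newton_coefs k i : (i <= k)%N ->
  nth 0 (newton_coefs k) i = newton_coef (k - i).
Proof.
elim: k i => [|k IHk] [|i] //; rewrite ltnS => le_ik.
by rewrite subSS -IHk.
Qed.

Lemma meval_newton_coefS (v : 'I_n -> C) k :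
  k.+1%:R * meval v (newton_coef k.+1)
  = - \sum_(i < n | (i <= k)%N) v i * meval v (newton_coef (k - i)).
Proof.
rewrite /newton_coef /= mevalZ mulrA mulrN divff ?pnatr_eq0 // mulN1r.
rewrite [meval v (\sum_(i < n | _) _)]raddf_sum /=.
congr (- _); apply: eq_bigr => i le_ik.
by rewrite mevalM mevalXU nth_newton_coefs.
Qed.

Lemma meval_newton_coef a k : (k <= n)%N ->
  meval (even_t a ord0) (newton_coef k) = (root_poly a)`_(n - k).
Proof.
have [m] := ubnP k; elim: m k => // m IHm [_ _|k lt_km lt_kn].
  by rewrite subn0 coef_root_poly_lead /newton_coef /= meval1.
have nz : k.+1%:R != 0 :> C by rewrite pnatr_eq0.
apply: (mulfI nz); rewrite meval_newton_coefS newton_identity //; congr (- _).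
apply: eq_bigr => i le_ik; rewrite IHm; last 2 first.
- by lia.
- by lia.
by congr (_ * _`_ _); lia.
Qed.

Definition newton_poly : {poly mpoly n C} := \poly_(i < n.+1) newton_coef (n - i).

Definition poly_of_power_sums x : {poly C} := map_poly (meval (x ord0)) newton_poly.

Lemma coef_poly_of_power_sums x i : (poly_of_power_sums x)`_i =
  if (i < n.+1)%N then meval (x ord0) (newton_coef (n - i)) else 0.
Proof.
by rewrite coef_map coef_poly; case: ifP => // _; rewrite /= meval0.
Qed.

Lemma newton_poly_monic : newton_poly \is monic.
Proof.
have nz : newton_coef (n - n) != 0 by rewrite subnn /newton_coef /= oner_eq0.
by rewrite monicE lead_coef_poly //= subnn.
Qed.

Lemma size_newton_poly : size newton_poly = n.+1.
Proof.
by rewrite size_poly_eq // subnn /newton_coef /= oner_eq0.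
Qed.

Lemma size_poly_of_power_sums x : size (poly_of_power_sums x) = n.+1.
Proof.
by rewrite size_map_poly_id0 ?size_newton_poly // (monicP newton_poly_monic) meval1 oner_neq0.
Qed.

Lemma poly_of_power_sums_monic x : poly_of_power_sums x \is monic.
Proof.
rewrite monicE lead_coefE size_poly_of_power_sums coef_poly_of_power_sums ltnSn.
by rewrite subnn /newton_coef /= meval1.
Qed.

Lemma poly_of_power_sums_even_t a : poly_of_power_sums (even_t a) = root_poly a.
Proof.
apply/polyP => i; rewrite coef_poly_of_power_sums; case: ltnP => [lt_in|le_ni].
  by rewrite meval_newton_coef ?leq_subr // subKn.
by rewrite nth_default // size_root_poly.
Qed.

(** Newton's recursion can be solved for the power sums: its term of index k is x_k times the
    leading coefficient 1, and the others involve earlier power sums only. *)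
Lemma even_t_of_root_poly x b : root_poly b = poly_of_power_sums x -> even_t b = x.
Proof.
move=> eP; apply/rowP => k.
have coefE j : (j <= n)%N ->
    meval (even_t b ord0) (newton_coef j) = meval (x ord0) (newton_coef j).
  move=> le_jn; rewrite meval_newton_coef // eP coef_poly_of_power_sums ltnS leq_subr.
  by rewrite subKn.
have [m] := ubnP k; elim: m k => // m IHm k; rewrite ltnS => le_km.
have := congr1 (fun z => k.+1%:R * z) (coefE k.+1 (ltn_ord k)).
rewrite !meval_newton_coefS (bigD1 k) //= [in RHS](bigD1 k) //= subnn.
rewrite /newton_coef /= !meval1 !mulr1 => /oppr_inj.
rewrite -/(newton_coef _) => /eqP.
rewrite (eq_bigr (fun i => x ord0 i * meval (x ord0) (newton_coef (k - i)))).
  by rewrite (inj_eq (addIr _)) => /eqP.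
move=> i /andP[le_ik nik]; rewrite coefE ?IHm //.
  by apply: leq_trans le_km; rewrite ltn_neqAle nik.
by apply: leq_trans (leq_subr _ _) (ltnW (ltn_ord _)).
Qed.

Lemma root_polyE a : root_poly a = \prod_(z <- [tuple a ord0 i | i < n]) ('X - z%:P).
Proof. by rewrite /= big_map /root_poly big_enum. Qed.

(** Equal power sums give equal root polynomials, hence the same roots up to order. *)
Lemma even_t_inj a b : even_t a = even_t b -> exists s, b = col_perm s a.
Proof.
move=> eab; have : root_poly b = root_poly a by rewrite -!poly_of_power_sums_even_t eab.
rewrite !root_polyE => /prod_XsubC_eq /tuple_permP[s es]; exists s.
apply/rowP => i; have := congr1 (fun t => tnth t i) (val_inj es).
by rewrite !tnth_mktuple mxE.
Qed.

Lemma even_t_perm a (s : 'S_n) : even_t (col_perm s a) = even_t a.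
Proof.
apply/rowP => k; rewrite !mxE [RHS](reindex_inj (@perm_inj _ s)) /=.
by apply: eq_bigr => i _; rewrite mxE.
Qed.

Lemma distinct_points_perm a (s : 'S_n) :
  distinct_points C n a -> distinct_points C n (col_perm s a).
Proof. by move=> da i j; rewrite !mxE => /da /perm_inj. Qed.

(** * Vandermonde determinants and alternants *)

Lemma det_Vandermonde_perm a (s : 'S_n) :
  \det (Vandermonde n (col_perm s a)) = (-1) ^+ s * \det (Vandermonde n a).
Proof.
have -> : Vandermonde n (col_perm s a) = col_perm s (Vandermonde n a).
  by apply/matrixP => i j; rewrite !mxE.
by rewrite col_permE det_mulmx det_perm odd_permV mulrC.
Qed.

Lemma det_Vandermonde_neq0 a :
  distinct_points C n a -> \det (Vandermonde n a) != 0.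
Proof.
move=> da; rewrite det_Vandermonde; apply/prodf_neq0 => i _.
apply/prodf_neq0 => j lt_ij; rewrite subr_eq0; apply/eqP => /da eji.
by rewrite eji ltnn in lt_ij.
Qed.

(** Division by [newton_poly] works over the polynomial ring because it is monic. Specialised at
    t(a), the divisor vanishes at a_j, and the remainder has degree below n. *)
Lemma expr_power_sums a (m : nat) j : a ord0 j ^+ m =
  \sum_(k < n) meval (even_t a ord0) (Pdiv.Ring.rmodp 'X^m newton_poly)`_k * a ord0 j ^+ k.
Proof.
have := Pdiv.RingMonic.rdivp_eq newton_poly_monic 'X^m.
move=> /(congr1 (fun p => (map_poly (meval (even_t a ord0)) p).[a ord0 j])).
rewrite map_polyXn hornerXn => ->; rewrite rmorphD rmorphM /=.
rewrite hornerD hornerM -/(poly_of_power_sums _) poly_of_power_sums_even_t.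
have -> : (root_poly a).[a ord0 j] = 0.
  by rewrite /root_poly horner_prod (bigD1 j) //= hornerXsubC subrr mul0r.
rewrite mulr0 add0r (@horner_coef_wide _ n).
  by apply: eq_bigr => k _; rewrite coef_map.
apply: leq_trans (size_poly _ _) _; rewrite -ltnS -size_newton_poly.
by rewrite Pdiv.Ring.ltn_rmodp monic_neq0 ?newton_poly_monic.
Qed.

(** A bialternant, that is, up to sign a Schur polynomial when the [m i] are distinct, written in
    the power sums. *)
Definition alternant_quotient (m : 'I_n -> nat) : mpoly n C :=
  \det (\matrix_(i < n, k < n) (Pdiv.Ring.rmodp 'X^(m i) newton_poly)`_k).

Lemma det_alternant a (m : 'I_n -> nat) :
  \det (\matrix_(i < n, j < n) a ord0 j ^+ m i)
  = meval (even_t a ord0) (alternant_quotient m) * \det (Vandermonde n a).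
Proof.
rewrite -det_map_mx -det_mulmx; congr (\det _).
apply/matrixP => i j; rewrite !mxE expr_power_sums.
by apply: eq_bigr => k _; rewrite !mxE.
Qed.

(* h * det V is antisymmetric, hence a combination of alternants, each of which is
   the product of the Vandermonde determinant and a polynomial in the power sums. *)
Lemma symmetric_quotient (h : 'rV[C]_n -> C) (q : mpoly n C) :
  (forall s a, distinct_points C n a -> h (col_perm s a) = h a) ->
  (forall a, distinct_points C n a ->
     \det (Vandermonde n a) * h a = meval (a ord0) q) ->
  exists p : mpoly n C,
    forall a, distinct_points C n a -> h a = meval (even_t a ord0) p.
Proof.
move=> hsym hq.
exists ((n`!)%:R^-1 *: \sum_(m <- msupp q) mcoeff m q *: alternant_quotient m) => a da.
have nz : (n`!)%:R != 0 :> C by rewrite pnatr_eq0 -lt0n fact_gt0.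
apply: (mulfI nz); apply: (mulfI (det_Vandermonde_neq0 da)).
rewrite mevalZ (mulrA n`!%:R) divff // mul1r raddf_sum /= mulr_sumr.
(* Antisymmetrising det V * h over S_n multiplies it by n!; antisymmetrising a monomial of [q]
   yields an alternant by the Leibniz formula. *)
transitivity (\sum_(s : 'S_n) (-1) ^+ s * meval (col_perm s a ord0) q).
  transitivity (\sum_(s : 'S_n) \det (Vandermonde n a) * h a).
    by rewrite sumr_const card_Sn -[RHS]mulr_natl mulrCA.
  apply: eq_bigr => s _; rewrite -hq; last exact: distinct_points_perm.
  by rewrite hsym // det_Vandermonde_perm mulrA signrMK.
under eq_bigr => s _ do rewrite mevalE mulr_sumr.
rewrite exchange_big /=; apply: eq_bigr => m _.
rewrite mevalZ mulrCA -[\det _ * _]mulrC -det_alternant mulr_sumr.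
apply: eq_bigr => s _; rewrite mulrCA; congr (_ * (_ * _)).
by apply: eq_bigr => i _; rewrite !mxE.
Qed.

End PowerSums.

Lemma even_t_surj (C : numClosedFieldType) n (x : 'rV[C]_n) : exists b, even_t b = x.
Proof.
have [r] := closed_field_poly_normal (poly_of_power_sums x).
rewrite (monicP (poly_of_power_sums_monic x)) scale1r => er.
have sr : size r = n.
  have := size_poly_of_power_sums x; rewrite er size_prod_XsubC => -[] //.
exists (\row_i nth 0 r i); apply: even_t_of_root_poly.
rewrite er root_polyE /=; apply: perm_big; rewrite perm_sym.
suff <- : r = [tuple (\row_i r`_i) ord0 i | i < n] :> seq _ by exact: perm_refl.
apply: (@eq_from_nth _ 0); first by rewrite size_tuple.
move=> i; rewrite sr => lt_in.
by rewrite (nth_map (Ordinal lt_in)) ?size_enum_ord // mxE nth_enum_ord.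
Qed.

(** * Nonvanishing of polynomials *)

Lemma sum_digits_inj N n (u v : 'I_n -> nat) :
  (forall i, (u i < N)%N) -> (forall i, (v i < N)%N) ->
  (\sum_(i < n) u i * N ^ i = \sum_(i < n) v i * N ^ i)%N -> u =1 v.
Proof.
elim: n u v => [|n IHn] u v uN vN; first by move=> _ [].
rewrite !big_ord_recl /= !muln1.
have sh (w : 'I_n.+1 -> nat) : (\sum_(i < n) w (lift ord0 i) * N ^ bump 0 i
    = (\sum_(i < n) w (lift ord0 i) * N ^ i) * N)%N.
  by rewrite big_distrl /=; apply: eq_bigr => i _; rewrite expnSr mulnA.
rewrite !sh => e.
have N0 : (0 < N)%N by apply: leq_trans (uN ord0).
have e0 : u ord0 = v ord0.
  have := congr1 (modn^~ N) e; rewrite !(addnC (_ ord0)) !modnMDl !modn_small //.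
move: e; rewrite e0 => /addnI /eqP; rewrite eqn_pmul2r // => /eqP e.
have := IHn (fun i => u (lift ord0 i)) (fun i => v (lift ord0 i)) (fun i => uN _) (fun i => vN _) e.
by move=> e1 i; case: (unliftP ord0 i) => [j ->|->].
Qed.

(* Kronecker's substitution: for N large, X_i |-> T ^ (N ^ i) separates the
   monomials of p. *)
Lemma meval_neq0 (C : numFieldType) n (p : mpoly n C) :
  p != 0 -> exists v : 'rV[C]_n, meval (v ord0) p != 0.
Proof.
move=> nz_p; pose N := (msize p).+1.
pose e (m : multinom n) := (\sum_(i < n) m i * N ^ i)%N.
pose q : {poly C} := \sum_(m <- msupp p) mcoeff m p *: 'X^(e m).
have mN m i : m \in msupp p -> (m i < N)%N.
  move=> /msize_mdeg_lt mp; rewrite ltnS; apply: leq_trans (ltnW mp).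
  by rewrite mdegE (bigD1 i) //= leq_addr.
have nz_q : q != 0.
  have m0 := mlead_supp nz_p.
  apply/eqP => /(congr1 (fun q : {poly C} => q`_(e (mlead p)))).
  rewrite coef0 coef_sum (bigD1_seq (mlead p)) ?msupp_uniq //= big_seq_cond big1.
    rewrite coefZ coefXn eqxx mulr1 addr0 => /eqP.
    by apply/negP; rewrite -mcoeff_msupp.
  move=> m /andP[mp nm]; rewrite coefZ coefXn; case: eqP => [em|]; last by rewrite mulr0.
  case/eqP: nm; apply/mnmP; apply: (sum_digits_inj (N := N)) => [i|i|]; rewrite ?mN //.
have [c nz_qc] : exists c : C, q.[c] != 0.
  (* A nonzero polynomial has fewer roots than its size, and in characteristic 0 these naturals are
     distinct. *)
  pose rs := [seq k%:R : C | k <- iota 0 (size q)].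
  have /allPn[c _ nz_qc] : ~~ all (root q) rs; last by exists c.
  apply/negP => /(max_poly_roots nz_q); rewrite size_map size_iota ltnn.
  rewrite map_inj_uniq ?iota_uniq => [/(_ isT)//|i j /eqP].
  by rewrite eqr_nat => /eqP.
exists (\row_i c ^+ (N ^ i)); rewrite mevalE.
rewrite horner_sum in nz_qc; congr (_ != 0): nz_qc.
apply: eq_bigr => m _; rewrite hornerZ hornerXn; congr (_ * _).
rewrite /e expr_sum; apply: eq_bigr => i _.
by rewrite mxE mulnC exprM.
Qed.

(** * Differentiable local sections of the power sum map *)

Local Open Scope classical_set_scope.

(** * Differentiability criteria *)

Section Differentiability.
Variables (C : numFieldType) (V : normedModType C).

Lemma differentiable_littleo (W : normedModType C) (r : V -> W) x0 : r x0 = 0 ->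
  (forall e : C, 0 < e -> \forall h \near 0, `|r (h + x0)| <= e * `|h : V|) ->
  differentiable r x0.
Proof.
move=> r0 ro.
have E : r \o shift x0 = cst (r x0) + \0 +o_ 0 id.
  apply/eqaddoP => e e0; near=> h.
  rewrite !fctE /= r0 addr0 subr0; near: h; exact: ro.
have d0 : 'd r x0 = \0 :> (V -> W) by apply: diff_unique => //; exact: cst_continuous.
by apply/diff_locallyP; rewrite d0; split=> //; exact: cst_continuous.
Unshelve. all: by end_near. Qed.

Lemma differentiable_near_eq (W : normedModType C) (f g : V -> W) x0 :
  (\forall x \near x0, f x = g x) -> differentiable g x0 -> differentiable f x0.
Proof.
move=> fg dg.
have -> : f = g + (f - g) by apply/funext => x; rewrite !fctE addrC subrK.
apply: differentiableD => //; apply: differentiable_littleo.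
  by rewrite !fctE (nbhs_singleton fg) subrr.
move=> e e0.
have : \forall h \near (0 : V), f (h + x0) = g (h + x0).
  by have := fg; rewrite (near_shift 0 x0) subr0.
apply: filterS => h /= fgh.
by rewrite !fctE fgh subrr normr0 mulr_ge0 // ltW.
Qed.

(** Mere continuity of [v] suffices: u v = v(x0) u + u (v - v(x0)), where u = O(h) makes the last
    term o(h). *)
Lemma differentiable_mul_vanishing (u v : V -> C) x0 :
  differentiable u x0 -> u x0 = 0 -> v x @[x --> x0] --> v x0 ->
  differentiable (fun x => u x * v x) x0.
Proof.
move=> du u0 cv.
have -> : (fun x => u x * v x) = (v x0 *: u) + (fun x => u x * (v x - v x0)).
  by apply/funext => x; rewrite !fctE /= mulrBr [_ *: _]mulrC addrC subrK.
apply: differentiableD; first exact: differentiableZ.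
apply: differentiable_littleo; first by rewrite u0 mul0r.
move=> e e0.
have [k k0 uk] := linear_lipschitz (diff_continuous du).
have k10 : 0 < k + 1 by rewrite addr_gt0.
have /eqaddoP/(_ 1 ltr01) uo := diff_locally du.
have ve : \forall h \near (0 : V), `|v (h + x0) - v x0| <= e / (k + 1).
  have : \forall x \near x0, `|v x0 - v x| <= e / (k + 1).
    by have /cvgrPdist_le/(_ _ (divr_gt0 e0 k10)) := cv.
  rewrite (near_shift 0 x0) subr0; apply: filterS => h /=.
  by rewrite distrC.
near=> h; rewrite normrM.
(* [k] bounds the differential of [u], and the extra 1 absorbs the little-o remainder. *)
have uh : `|u (h + x0)| <= (k + 1) * `|h|.
  have : `|(u \o shift x0 - (cst (u x0) + 'd u x0)) h| <= 1 * `|h| by near: h.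
  rewrite !fctE /= u0 add0r mul1r mulrDl mul1r => uh.
  rewrite -[u _](subrK ('d u x0 h)) addrC (le_trans (ler_normD _ _)) // lerD //.
apply: le_trans (_ : (k + 1) * `|h| * (e / (k + 1)) <= _).
  by apply: ler_pM => //; near: h.
by rewrite mulrC -mulrA mulKf ?gt_eqF.
Unshelve. all: by end_near. Qed.

End Differentiability.

Section BigOperators.
Variables (C : numFieldType) (V : normedModType C).

Lemma differentiable_big_sum (I : Type) (r : seq I) (f : I -> V -> C) x :
  (forall i, differentiable (f i) x) ->
  differentiable (fun y => \sum_(i <- r) f i y) x.
Proof.
move=> df; elim: r => [|i r IHr].
  by under eq_fun do rewrite big_nil; exact: differentiable_cst.
by under eq_fun do rewrite big_cons; exact: differentiableD.
Qed.

Lemma differentiable_big_prod (I : Type) (r : seq I) (f : I -> V -> C) x :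
  (forall i, differentiable (f i) x) ->
  differentiable (fun y => \prod_(i <- r) f i y) x.
Proof.
move=> df; elim: r => [|i r IHr].
  by under eq_fun do rewrite big_nil; exact: differentiable_cst.
by under eq_fun do rewrite big_cons; exact: differentiableM.
Qed.

Lemma cvg_big_prod (T : Type) (F : set_system T) (FF : Filter F)
    (I : Type) (r : seq I) (P : pred I) (f : I -> T -> C) (l : I -> C) :
  (forall i, P i -> f i y @[y --> F] --> l i) ->
  (\prod_(i <- r | P i) f i y) @[y --> F] --> \prod_(i <- r | P i) l i.
Proof.
move=> fl; elim: r => [|i r IHr].
  by under eq_fun do rewrite big_nil; rewrite big_nil; exact: cvg_cst.
under eq_fun do rewrite big_cons; rewrite big_cons; case: ifP => [Pi|_ //].
by apply: cvgM => //; exact: fl.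
Qed.
End BigOperators.

Lemma differentiable_meval (C : numFieldType) n (p : mpoly n C) (a : 'rV[C]_n) :
  differentiable (fun x : 'rV[C]_n => meval (x ord0) p : C) a.
Proof.
under eq_fun do rewrite mevalE.
apply: differentiable_big_sum => m.
apply: (@differentiableM _ _ (cst (mcoeff m p))) => //.
apply: differentiable_big_prod => i.
elim: (m i) => [|k IHk]; first exact: differentiable_cst.
under eq_fun do rewrite exprS.
by apply: differentiableM => //; exact: differentiable_coord.
Qed.

(** * Simple roots as functions of the power sums *)

Section LocalInverse.
Variables (C : numClosedFieldType) (n : nat).
Implicit Types (a b x : 'rV[C]_n).

Lemma horner_poly_of_power_sums b z :
  (poly_of_power_sums (even_t b)).[z] = \prod_j (z - b ord0 j).
Proof.
rewrite poly_of_power_sums_even_t horner_prod.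
by apply: eq_bigr => j _; rewrite hornerXsubC.
Qed.

Lemma differentiable_poly_of_power_sums (z : C) a :
  differentiable (fun x : 'rV[C]_n => (poly_of_power_sums x).[z] : C) a.
Proof.
under eq_fun => x do rewrite (@horner_coef_wide _ n.+1) ?size_poly_of_power_sums //.
apply: differentiable_big_sum => i.
apply: differentiableM => //.
under eq_fun do rewrite coef_poly_of_power_sums ltn_ord.
exact: differentiable_meval.
Qed.

Lemma separated a : distinct_points C n a ->
  exists2 e : C, 0 < e & forall i j, i != j -> e <= `|a ord0 i - a ord0 j|.
Proof.
(* 1 + S dominates every inverse distance; diagonal pairs contribute 0, and the 1 keeps the bound
   positive when there are no other pairs. *)
move=> da; pose S := \sum_(p : 'I_n * 'I_n) `|a ord0 p.1 - a ord0 p.2|^-1.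
have S0 : 0 <= S by apply: sumr_ge0 => p _; rewrite invr_ge0.
have S1 : 0 < 1 + S by rewrite ltr_pwDl.
exists (1 + S)^-1 => [|i j nij]; first by rewrite invr_gt0.
have nz : 0 < `|a ord0 i - a ord0 j|.
  by rewrite normr_gt0 subr_eq0; apply: contra nij => /eqP/da->.
rewrite -[leRHS]invrK lef_pV2 ?posrE ?invr_gt0 //.
rewrite (le_trans _ (_ : S <= _)) ?lerDr //.
rewrite /S (bigD1 (i, j)) //= lerDl.
by apply: sumr_ge0 => p _; rewrite invr_ge0.
Qed.

(** Otherwise, multiplying n strict inequalities would give P^n < P^n for the product P; [i] ensures
    that n is positive. *)
Lemma exists_expr_le_prod (y : 'I_n -> C) (i : 'I_n) : (forall j, 0 <= y j) ->
  exists j, y j ^+ n <= \prod_j y j.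
Proof.
move=> y0; apply: contrapT => /forallNP ny.
have P0 : 0 <= \prod_j y j by apply: prodr_ge0.
have ly j : \prod_j y j < y j ^+ n.
  by rewrite real_ltNge ?ger0_real ?exprn_ge0 //; apply/negP/ny.
have : \prod_(j < n) \prod_j y j < \prod_(j < n) y j ^+ n.
  apply: ltr_prod; first by apply/hasP; exists i; rewrite ?mem_index_enum.
  by move=> j _; rewrite P0 ly.
by rewrite prodr_const card_ord prodrXl ltxx.
Qed.

(* For x near t(a) the polynomial with power sums x is small at a_i, so that one of its
   roots b_j is close to a_i. *)
Definition close_preimage a (e : C) x b :=
  [/\ even_t b = x,
      forall i, `|a ord0 i - b ord0 i| ^+ n <= `|(poly_of_power_sums x).[a ord0 i]|
    & forall i, `|a ord0 i - b ord0 i| < e].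

Lemma exists_close_preimage a (e : C) x :
  0 < e -> (forall i j, i != j -> e + e <= `|a ord0 i - a ord0 j|) ->
  (forall i, `|(poly_of_power_sums x).[a ord0 i]| < e ^+ n) ->
  exists b, close_preimage a e x b.
Proof.
move=> e0 sep small; have [c cx] := even_t_surj x.
have /choice[F FP] i : exists j,
    `|a ord0 i - c ord0 j| ^+ n <= `|(poly_of_power_sums x).[a ord0 i]|.
  rewrite -cx horner_poly_of_power_sums normr_prod.
  by apply: (exists_expr_le_prod (y := fun j => `|a ord0 i - c ord0 j|)).
have Fe i : `|a ord0 i - c ord0 (F i)| < e.
  have n0 : (0 < n)%N by apply: leq_ltn_trans (ltn_ord i).
  rewrite -(ltr_pXn2r n0) ?nnegrE ?normr_ge0 ?(ltW e0) //.
  exact: le_lt_trans (FP i) (small i).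
(* One root within [e] of two points would contradict their separation by 2e, so the chosen roots
   are a reordering of [c]. *)
have Finj : injective F.
  move=> i j eF; apply: contrapT => /eqP nij; have := sep _ _ nij.
  apply/negP; rewrite -real_ltNge ?ger0_real ?addr_ge0 ?(ltW e0) //.
  rewrite -(subrK (c ord0 (F i)) (a ord0 i)) -addrA (le_lt_trans (ler_normD _ _)) //.
  by rewrite ltrD // {1}eF distrC.
exists (col_perm (perm Finj) c); split=> [|i|i]; first by rewrite even_t_perm.
  by rewrite mxE permE.
by rewrite mxE permE.
Qed.

Lemma close_preimage_distinct a e x b :
  0 < e -> (forall i j, i != j -> e + e <= `|a ord0 i - a ord0 j|) ->
  close_preimage a e x b -> distinct_points C n b.
Proof.
move=> e0 sep [_ _ close] i j eb; apply: contrapT => /eqP nij; have := sep _ _ nij.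
apply/negP; rewrite -real_ltNge ?ger0_real ?addr_ge0 ?(ltW e0) //.
rewrite -(subrK (b ord0 i) (a ord0 i)) -addrA (le_lt_trans (ler_normD _ _)) //.
by rewrite ltrD // {1}eb distrC.
Qed.

(** Let P_x be the polynomial with power sums x. The bound on |a_i - s_i(x)|^n by |P_x(a_i)| makes s
    continuous at t(a). Then s_i(x) = a_i - P_x(a_i) / prod_(j != i) (a_i - s_j(x)), where the
    numerator is differentiable and vanishes at t(a), so continuity of the other factor is
    enough. *)
Lemma even_t_local_inverse a : distinct_points C n a ->
  exists s : 'rV[C]_n -> 'rV[C]_n,
    [/\ s (even_t a) = a,
        \forall x \near even_t a, even_t (s x) = x /\ distinct_points C n (s x)
      & differentiable s (even_t a)].
Proof.
move=> da; have [e' e'0 sep'] := separated da.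
pose e := e' / 2; have e0 : 0 < e by rewrite divr_gt0.
have sep i j : i != j -> e + e <= `|a ord0 i - a ord0 j|.
  by rewrite -splitr; exact: sep'.
pose s x := xget 0 [set b | close_preimage a e x b].
set x0 := even_t a.
have Fx0 : Filter (nbhs x0) by exact: nbhs_filter.
have Pa0 i : (poly_of_power_sums x0).[a ord0 i] = 0.
  by rewrite horner_poly_of_power_sums (bigD1 i) //= subrr mul0r.
have Pcvg i : (poly_of_power_sums x).[a ord0 i] @[x --> x0] --> (0 : C).
  have := differentiable_continuous (differentiable_poly_of_power_sums (a ord0 i) x0).
  by rewrite /prop_for /continuous_at Pa0.
have small (d : C) : 0 < d ->
    \forall x \near x0, forall i, `|(poly_of_power_sums x).[a ord0 i]| < d.
  move=> d0.
  have sm i : \forall x \near x0, `|(poly_of_power_sums x).[a ord0 i]| < d.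
    by have /cvgr0Pnorm_lt/(_ _ d0) := Pcvg i.
  exact: (@filter_forall _ _
    (fun i x => `|(poly_of_power_sums x).[a ord0 i]| < d) (nbhs x0) _ sm).
have sP : \forall x \near x0, close_preimage a e x (s x).
  have := small _ (exprn_gt0 n e0); apply: filterS => x sx.
  by have [b bP] := exists_close_preimage e0 sep sx; apply: (xgetPex 0); exists b.
have scvg i : s x ord0 i @[x --> x0] --> a ord0 i.
  apply/(cvgrPdist_lt (FF := nbhs_filter x0)) => d d0; near=> x.
  have n0 : (0 < n)%N by apply: leq_ltn_trans (ltn_ord i).
  rewrite -(ltr_pXn2r n0) ?nnegrE ?normr_ge0 ?(ltW d0) //.
  have [_ sx _] : close_preimage a e x (s x) by near: x.
  apply: le_lt_trans (sx i) _.
  have : forall i, `|(poly_of_power_sums x).[a ord0 i]| < d ^+ n.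
    by near: x; apply: small; rewrite exprn_gt0.
  exact.
have sx0 : s x0 = a.
  have [_ close _] := nbhs_singleton sP.
  apply/rowP => i; have n0 : (0 < n)%N by apply: leq_ltn_trans (ltn_ord i).
  have := close i; rewrite Pa0 normr0 -normrX normr_le0 expf_eq0 n0 /=.
  by rewrite subr_eq0 => /eqP ->.
exists s; split=> //.
  apply: filterS sP => x sx; split; first by case: sx.
  exact: close_preimage_distinct sep sx.
have ds i : differentiable (fun x => s x ord0 i : C) x0.
  pose v x := - (\prod_(j | j != i) (a ord0 i - s x ord0 j))^-1.
  apply: (@differentiable_near_eq _ _ _ _
      (cst (a ord0 i) + (fun x => (poly_of_power_sums x).[a ord0 i] * v x))).
    apply: filterS sP => x sx; have [tx _ close] := sx.
    (* [s x ord0 j] lies within [e] of a_j, while a_i is at distance at least 2e from a_j. *)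
    have nz : \prod_(j | j != i) (a ord0 i - s x ord0 j) != 0.
      apply/prodf_neq0 => j nji; apply/eqP => e1.
      have := sep _ _ nji; rewrite -normrN opprB -(subrK (s x ord0 j) (a ord0 i)) e1.
      rewrite add0r -normrN opprB => le_ee.
      by have := le_lt_trans le_ee (close j); rewrite gtrDl (lt_gtF e0).
    rewrite !fctE /= /v -[in poly_of_power_sums x]tx horner_poly_of_power_sums.
    by rewrite (bigD1 i) //= mulrN mulfK // opprB addrC subrK.
  apply: differentiableD => //; apply: differentiable_mul_vanishing => //.
    exact: differentiable_poly_of_power_sums.
  apply: cvgN; apply: cvgV.
    rewrite sx0; apply/prodf_neq0 => j nji; rewrite subr_eq0.
    by apply: contra nji => /eqP/da->.
  apply: cvg_big_prod => j _; apply: cvgB; first exact: cvg_cst.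
  by rewrite sx0; exact: scvg.
have -> : s = fun x => \sum_(i < n) s x ord0 i *: delta_mx ord0 i.
  by apply/funext => x; rewrite {1}[s x]row_sum_delta.
elim: (index_enum _) => [|i r IHr].
  by under eq_fun do rewrite big_nil; exact: differentiable_cst.
under eq_fun do rewrite big_cons.
by apply: differentiableD => //; exact: differentiableZl.
Unshelve. all: by end_near. Qed.

End LocalInverse.

(** * The coefficients of a symmetric superfunction *)

Section PolynomialFunction.
Variables (C : numFieldType) (n : nat).
Implicit Types (h : 'rV[C]_n -> C).

Definition polynomial_fun h :=
  exists p : mpoly n C, forall x, h x = meval (x ord0) p.

Lemma polynomial_fun_meval (p : mpoly n C) :
  polynomial_fun (fun x => meval (x ord0) p).
Proof. by exists p. Qed.

Lemma polynomial_fun_cst (c : C) : polynomial_fun (fun=> c).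
Proof. by exists (mpolyC n c) => x; rewrite mevalC. Qed.

Lemma polynomial_fun_coord i : polynomial_fun (fun x => x ord0 i).
Proof. by exists (mpolyX C (mnm1 i)) => x; rewrite mevalXU. Qed.

Lemma polynomial_funD h1 h2 : polynomial_fun h1 -> polynomial_fun h2 ->
  polynomial_fun (fun x => h1 x + h2 x).
Proof. by move=> [p hp] [q hq]; exists (p + q) => x; rewrite mevalD hp hq. Qed.

Lemma polynomial_funM h1 h2 : polynomial_fun h1 -> polynomial_fun h2 ->
  polynomial_fun (fun x => h1 x * h2 x).
Proof. by move=> [p hp] [q hq]; exists (p * q) => x; rewrite mevalM hp hq. Qed.

Lemma polynomial_funX h k : polynomial_fun h -> polynomial_fun (fun x => h x ^+ k).
Proof. by move=> [p hp]; exists (p ^+ k) => x; rewrite rmorphXn /= hp. Qed.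

Lemma polynomial_fun_sum (I : Type) (r : seq I) (P : pred I) (F : I -> 'rV[C]_n -> C) :
  (forall i, polynomial_fun (F i)) -> polynomial_fun (fun x => \sum_(i <- r | P i) F i x).
Proof.
move=> FP; elim: r => [|i r IHr].
  by under eq_fun do rewrite big_nil; exact: polynomial_fun_cst.
under eq_fun do rewrite big_cons; case: (P i) => //.
exact: polynomial_funD.
Qed.

Lemma polynomial_fun_prod (I : Type) (r : seq I) (P : pred I) (F : I -> 'rV[C]_n -> C) :
  (forall i, polynomial_fun (F i)) -> polynomial_fun (fun x => \prod_(i <- r | P i) F i x).
Proof.
move=> FP; elim: r => [|i r IHr].
  by under eq_fun do rewrite big_nil; exact: polynomial_fun_cst.
under eq_fun do rewrite big_cons; case: (P i) => //.
exact: polynomial_funM.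
Qed.

Lemma differentiable_polynomial_fun h a : polynomial_fun h -> differentiable h a.
Proof.
move=> [p hp]; have -> : h = fun x => meval (x ord0) p by apply/funext.
exact: differentiable_meval.
Qed.

Lemma polynomial_fun_perm (p : mpoly n C) (s : 'S_n) :
  polynomial_fun (fun x => meval (col_perm s x ord0) p).
Proof.
under eq_fun do rewrite mevalE.
apply: polynomial_fun_sum => m; apply: polynomial_funM; first exact: polynomial_fun_cst.
apply: polynomial_fun_prod => i; apply: polynomial_funX.
by under eq_fun do rewrite mxE; exact: polynomial_fun_coord.
Qed.

Lemma polynomial_fun_Vandermonde :
  polynomial_fun (fun x : 'rV[C]_n => \det (Vandermonde n x)).
Proof.
apply: polynomial_fun_sum => s; apply: polynomial_funM; first exact: polynomial_fun_cst.
apply: polynomial_fun_prod => i; under eq_fun do rewrite mxE.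
exact/polynomial_funX/polynomial_fun_coord.
Qed.

Lemma polynomial_fun_prod_linear_forms (r : seq 'I_n) (L : {set 'I_n}) :
  polynomial_fun (fun x => (\prod_(i <- r) linear_forms (Vandermonde n x) i) L).
Proof.
elim: r L => [|i r IHr] L.
  by under eq_fun do rewrite big_nil ffunE; exact: polynomial_fun_cst.
under eq_fun do rewrite big_cons grassmann_mulE.
apply: polynomial_fun_sum => I; apply: polynomial_funM; first exact: polynomial_fun_cst.
apply: polynomial_funM => //; under eq_fun do rewrite grassmann_sumE.
apply: polynomial_fun_sum => k; under eq_fun do rewrite grassmannZE mxE.
apply: polynomial_funM; last exact: polynomial_fun_cst.
exact/polynomial_funX/polynomial_fun_coord.
Qed.

Lemma exists_distinct_nonzero (p : mpoly n C) : p != 0 ->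
  exists2 a, distinct_points C n a & meval (a ord0) p != 0.
Proof.
move=> nz_p; have [v Pv] := polynomial_fun_Vandermonde.
have nz_v : v != 0.
  (* The point (0, 1, ..., n-1) has distinct entries, so the Vandermonde polynomial is nonzero. *)
  pose a : 'rV[C]_n := \row_i (i : nat)%:R.
  apply/eqP => v0; have /eqP := Pv a; rewrite v0 meval0; apply/negP.
  apply: det_Vandermonde_neq0 => i j; rewrite !mxE => /eqP.
  by rewrite eqr_nat => /eqP/val_inj.
have [a] := meval_neq0 (mulf_neq0 nz_v nz_p).
rewrite mevalM -Pv mulf_eq0 negb_or => /andP[nz_det nz_pa]; exists a => // i j eij.
have ndiff (k l : 'I_n) : (k < l)%N -> a ord0 k = a ord0 l -> False.
  move=> lt_kl ekl; case/eqP: nz_det; rewrite det_Vandermonde (bigD1 k) //=.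
  by rewrite (bigD1 l) //= ekl subrr !mul0r.
apply: val_inj; case: (ltngtP i j) => // lt; exfalso; first exact: ndiff eij.
exact: ndiff (esym eij).
Qed.

End PolynomialFunction.

(** * Expansion in the monomials in tau *)

Section PowerSumCoefficients.
Variables (C : numFieldType) (n : nat) (f : superfun C n).
Implicit Types (a x : 'rV[C]_n) (I J : {set 'I_n}).

Lemma odd_tauE a : odd_tau a =1 linear_forms (Vandermonde n a).
Proof. by move=> k; apply: eq_bigr => i _; rewrite mxE. Qed.

Lemma supereval_odd_tau (g : superfun C n) x a :
  supereval g x (odd_tau a) = odd_subst (linear_forms (Vandermonde n a)) (g x).
Proof. exact: eq_odd_subst (odd_tauE a) _. Qed.

(* The coefficients of f a in the monomials in tau_1(a), ..., tau_n(a). *)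
Definition tau_coef a : grassmann C n :=
  odd_subst (linear_forms (invmx (Vandermonde n a))) (f a).

Lemma Vandermonde_unit a : distinct_points C n a -> Vandermonde n a \in unitmx.
Proof. by move=> da; rewrite unitmxE unitfE det_Vandermonde_neq0. Qed.

Lemma odd_subst_tau_coef a : Vandermonde n a \in unitmx ->
  odd_subst (linear_forms (Vandermonde n a)) (tau_coef a) = f a.
Proof. by move=> ua; rewrite odd_subst_comp mulVmx // odd_subst_linear_forms1. Qed.

Lemma tau_coef_unique a h : distinct_points C n a ->
  odd_subst (linear_forms (Vandermonde n a)) h = f a -> h = tau_coef a.
Proof.
move=> /Vandermonde_unit ua hf.
by rewrite /tau_coef -hf odd_subst_comp mulmxV // odd_subst_linear_forms1.
Qed.

(** No inverse matrix remains on the right: the expression is polynomial in the coefficients of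
    [f a] and the entries of V(a). *)
Lemma det_mul_tau_coef a I : Vandermonde n a \in unitmx ->
  \det (Vandermonde n a) * tau_coef a I = (-1) ^+ inversions I (~: I) *
  \sum_(J : {set 'I_n}) (-1) ^+ inversions J (~: J) * (f a J *
     (\prod_(i <- enum (~: I)) linear_forms (Vandermonde n a) i) (~: J)).
Proof.
move=> ua; rewrite det_mul_coef odd_subst_tau_coef // grassmann_mulE; congr (_ * _).
by apply: eq_big => J; rewrite ?finset.subsetT ?finset.setTD.
Qed.

(** Permuting the a_i and the alpha_i together fixes every tau_k, so the coefficients at the
    permuted point also expand [f a]; uniqueness concludes. *)
Lemma tau_coef_perm (s : 'S_n) a : symmetric_superfun f -> distinct_points C n a ->
  tau_coef (col_perm s a) = tau_coef a.
Proof.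
move=> fsym da; apply: tau_coef_unique => //.
have ua := Vandermonde_unit (distinct_points_perm (s := s) da).
rewrite -(fsym s a da) /supereval -/(odd_subst _ _) -(odd_subst_tau_coef ua).
rewrite -(eq_odd_subst (linear_forms_perm C s)) odd_subst_comp.
congr (odd_subst (linear_forms _) _); apply/matrixP => i j; rewrite !mxE.
rewrite (bigD1 (s^-1%g j)) //= big1 ?addr0 => [|k /negPf nk].
  by rewrite !mxE permKV eqxx mulr1.
rewrite !mxE (canF_eq (permK s)) nk mulr0 //.
Qed.

Lemma differentiable_tau_coef I a :
  superfun_on (distinct_points C n) f -> distinct_points C n a ->
  differentiable (fun x => tau_coef x I : C) a.
Proof.
move=> fhol da; have nz := det_Vandermonde_neq0 da.
have dV := differentiable_polynomial_fun a (polynomial_fun_Vandermonde C n).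
pose num x := (-1) ^+ inversions I (~: I) *
  \sum_(J : {set 'I_n}) (-1) ^+ inversions J (~: J) * (f x J *
     (\prod_(i <- enum (~: I)) linear_forms (Vandermonde n x) i) (~: J)).
apply: (@differentiable_near_eq _ _ _ _ (fun x => (\det (Vandermonde n x))^-1 * num x)).
  have : \forall x \near a, \det (Vandermonde n x) != 0.
    exact: cvgr_neq0 (differentiable_continuous dV) nz.
  apply: filterS => x nzx.
  by rewrite /num -det_mul_tau_coef ?unitmxE ?unitfE // mulKf.
apply: differentiableM; first exact: differentiableV.
apply: differentiableM => //; apply: differentiable_big_sum => J.
apply: differentiableM => //; apply: differentiableM; first exact: fhol.
exact/differentiable_polynomial_fun/polynomial_fun_prod_linear_forms.
Qed.

(** The symmetric weight [d] is 1 for polynomial [f] and clears the denominators for rational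
    [f]. *)
Lemma tau_coef_polynomial (d : 'rV[C]_n -> C) I :
  symmetric_superfun f ->
  (forall s a, distinct_points C n a -> d (col_perm s a) = d a) ->
  (forall J, exists p : mpoly n C, forall a, distinct_points C n a ->
     d a * f a J = meval (a ord0) p) ->
  exists p : mpoly n C, forall a, distinct_points C n a ->
    d a * tau_coef a I = meval (even_t a ord0) p.
Proof.
move=> fsym dsym /choice[p dfp].
pose num x := (-1) ^+ inversions I (~: I) *
  \sum_(J : {set 'I_n}) (-1) ^+ inversions J (~: J) * (meval (x ord0) (p J) *
     (\prod_(i <- enum (~: I)) linear_forms (Vandermonde n x) i) (~: J)).
have [q Pq] : polynomial_fun num.
  apply: polynomial_funM; first exact: polynomial_fun_cst.
  apply: polynomial_fun_sum => J; apply: polynomial_funM; first exact: polynomial_fun_cst.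
  apply: polynomial_funM; first exact: polynomial_fun_meval.
  exact: polynomial_fun_prod_linear_forms.
apply: (symmetric_quotient (h := fun a => d a * tau_coef a I) (q := q)) => [s a da|a da].
  by rewrite dsym // tau_coef_perm.
rewrite mulrCA det_mul_tau_coef ?Vandermonde_unit // -Pq /num mulrCA; congr (_ * _).
rewrite mulr_sumr; apply: eq_bigr => J _; rewrite mulrCA; congr (_ * _).
by rewrite mulrA dfp.
Qed.

Lemma tau_coef_rational I :
  symmetric_superfun f -> rational_superfun (distinct_points C n) f ->
  exists p q : mpoly n C, q != 0 /\ forall a, distinct_points C n a ->
    meval (even_t a ord0) q * tau_coef a I = meval (even_t a ord0) p.
Proof.
move=> fsym /choice[p /choice[q Pq]].
(* [r (s, J)] is the denominator [q J] permuted by [s]; the product of all of them is symmetric. *)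
have /choice[r Pr] (u : 'S_n * {set 'I_n}) : exists r : mpoly n C,
    r != 0 /\ forall a, meval (a ord0) r = meval (col_perm u.1 a ord0) (q u.2).
  have [r Pr] := polynomial_fun_perm (q u.2) u.1; exists r; split=> //.
  have [v nz] := meval_neq0 (Pq u.2).1; apply: contra nz => /eqP r0.
  have := Pr (col_perm u.1^-1%g v); rewrite r0 meval0 => e.
  rewrite [X in X == _](_ : _ = meval (col_perm u.1 (col_perm u.1^-1%g v) ord0) (q u.2)).
    by rewrite e.
  by apply: meval_eq => i; rewrite !mxE permK.
(* One factor D clears the denominators, the other one makes both sides vanish
   where a denominator does: the values of f are arbitrary there. *)
pose D := \prod_u r u; pose d a := meval (a ord0) D ^+ 2.
have dsym s a : d (col_perm s a) = d a.
  rewrite /d /D !rmorph_prod /=; congr (_ ^+ 2).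
  rewrite (reindex_inj (h := fun u : 'S_n * {set 'I_n} => (u.1 * s^-1, u.2)%g)) /=; last first.
    by move=> [u J] [u' J'] [/mulIg-> ->].
  apply: eq_bigr => -[u J] _; rewrite !(Pr _).2 /=; apply: meval_eq => i.
  by rewrite !mxE permM permKV.
have [J|P PP] := @tau_coef_polynomial d I fsym (fun s a _ => dsym s a).
  pose D' := \prod_(u | u != (1%g, J)) r u.
  exists (D * D' * p J) => a da.
  have DE : D = r (1%g, J) * D' by rewrite /D (bigD1 (1%g, J)).
  have rE : meval (a ord0) (r (1%g, J)) = meval (a ord0) (q J).
    by rewrite (Pr _).2; apply: meval_eq => i; rewrite !mxE perm1.
  rewrite /d !mevalM {1 2}DE !mevalM rE.
  have [q0|nz] := eqVneq (meval (a ord0) (q J)) 0.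
    by rewrite q0 !(mul0r, expr0n).
  by rewrite ((Pq J).2 a da nz) expr2; field.
have [V PV] := polynomial_fun_Vandermonde C n.
(* [d] is itself a symmetric polynomial, hence a polynomial in the power sums, which serves as
   denominator. *)
have [E PE] : exists E : mpoly n C, forall a, distinct_points C n a ->
    d a = meval (even_t a ord0) E.
  apply: (@symmetric_quotient _ _ d (V * D ^+ 2)) => // a da.
  by rewrite mevalM rmorphXn /= -PV.
have nz_D : D != 0 by apply/prodf_neq0 => u _; exact: (Pr u).1.
exists P, E; split=> [|a da]; last by rewrite -PE // PP.
have [a da nz] := exists_distinct_nonzero nz_D.
apply: contra nz => /eqP E0; have := PE a da; rewrite E0 meval0 /d => /eqP.
by rewrite expf_eq0.
Qed.

End PowerSumCoefficients.

(** * Descent to the image of the power sum map *)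

Theorem superfun_of_power_sums (C : numClosedFieldType) (n : nat) (f : superfun C n) :
  superfun_on (distinct_points C n) f ->
  symmetric_superfun f ->
  exists g : superfun C n,
    [/\ superfun_on (power_sum_points C n) g
        /\ (forall a, distinct_points C n a ->
              supereval g (even_t a) (odd_tau a) = f a),
        (forall g' : superfun C n,
           superfun_on (power_sum_points C n) g' ->
           (forall a, distinct_points C n a ->
              supereval g' (even_t a) (odd_tau a) = f a) ->
           forall x, power_sum_points C n x -> g' x = g x),
        polynomial_superfun (distinct_points C n) f ->
        polynomial_superfun (power_sum_points C n) g
      & rational_superfun (distinct_points C n) f ->
        rational_superfun (power_sum_points C n) g].
Proof.
move=> fhol fsym.
(* Any preimage with distinct entries may be chosen, by invariance of [tau_coef]; off the image the
   default 0 is used. *)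
pose g x := tau_coef f (xget 0 [set a | distinct_points C n a /\ even_t a = x]).
have gE a : distinct_points C n a -> g (even_t a) = tau_coef f a.
  move=> da; rewrite /g; case: xgetP => [b _ [db /esym/even_t_inj[s ->]]|/(_ a)[]//].
  exact: tau_coef_perm.
exists g; split.
- split=> [I x [a da <-{x}]|a da].
    have [s [sa sP ds]] := even_t_local_inverse da.
    (* The chosen preimages need not vary continuously, but near t(a) they may be replaced by the
       section [s]. *)
    apply: (@differentiable_near_eq _ _ _ _ ((fun x => tau_coef f x I : C) \o s)).
      by apply: filterS sP => x [tx dx]; rewrite /= -gE // tx.
    apply: differentiable_comp => //; rewrite sa; exact: differentiable_tau_coef.
  rewrite supereval_odd_tau gE // odd_subst_tau_coef //; exact: Vandermonde_unit.
- move=> g' _ g'P x [a da <-]; rewrite gE //; apply: tau_coef_unique => //.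
  by rewrite -supereval_odd_tau g'P.
- move=> fpol I.
  have [J|p pP] := @tau_coef_polynomial _ _ f (fun=> 1) I fsym (fun _ _ _ => erefl).
    by have [p pP] := fpol J; exists p => a da; rewrite mul1r pP.
  by exists p => x [a da <-]; rewrite gE // -pP // mul1r.
- move=> frat I; have [p [q [nz_q pq]]] := tau_coef_rational I fsym frat.
  exists p, q; split=> // x [a da <-] nz.
  by rewrite gE // -pq // mulrAC divff // mul1r.
Qed.

Theorem mainTheorem3 (R : realType) (n : nat) (f : superfun (complex R) n) :
  superfun_on (distinct_points (complex R) n) f ->
  symmetric_superfun f ->
  exists g : superfun (complex R) n,
    [/\ superfun_on (power_sum_points (complex R) n) g
        /\ (forall a, distinct_points (complex R) n a ->
              supereval g (even_t a) (odd_tau a) = f a),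
        (forall g' : superfun (complex R) n,
           superfun_on (power_sum_points (complex R) n) g' ->
           (forall a, distinct_points (complex R) n a ->
              supereval g' (even_t a) (odd_tau a) = f a) ->
           forall x, power_sum_points (complex R) n x -> g' x = g x),
        polynomial_superfun (distinct_points (complex R) n) f ->
        polynomial_superfun (power_sum_points (complex R) n) g
      & rational_superfun (distinct_points (complex R) n) f ->
        rational_superfun (power_sum_points (complex R) n) g].
Proof. exact: superfun_of_power_sums. Qed.
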